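(* Let $(\Omega,\mathcal F,\mathbb P)$, $\theta$, $f$ be as in the context, and let $\mu(d\omega,ds)=\nu_\omega(ds)\,\mathbb P(d\omega)$ be an invariant probability measure on $\Omega\times S^1$ for the skew product $\Theta(\omega,s)=(\theta(\omega),f(\omega,s))$. Let $q,\alpha\in\mathbb R$. Then the $(q,\alpha)$-rotation number $\rho_{q,\alpha}=\lim_{n\to\infty}\frac{F^n(\omega,x)-x}{n}$ exists $\mathbb P$-almost surely (for every $x\in\mathbb R$, with value independent of $x$), and $$\rho_{q,\alpha}=\mathbb E\int_{S^1}\delta_{q,\alpha}(\omega,p^{-1}(s))\,d\nu_\omega(s)\qquad \mathbb P\text{-a.s.}$$
   Context: $(\Omega,\mathcal F,\mathbb P)$ is a probability space, $\theta:\Omega\to\Omega$ is a measure-preserving transformation that is ergodic with respect to $\mathbb P$, and $f:\Omega\times S^1\to S^1$ is a random variable with values in $\mathcal H^+$, the space of orientation-preserving homeomorphisms of $S^1$ (so $f(\omega,\cdot)\in\mathcal H^+$ for each $\omega$). The covering map is $p:\mathbb R\to S^1$, $p(x)=e^{2\pi i x}$. A lift of $g\in\mathcal H^+$ is an increasing continuous function $G:\mathbb R\to\mathbb R$ with $p\circ G=g\circ p$; lifts are unique up to addition of an integer. For $q,\alpha\in\mathbb R$, $F_{q,\alpha}(\omega,\cdot)$ denotes the unique lift of $f(\omega,\cdot)$ with $F_{q,\alpha}(\omega,q)\in[\alpha,\alpha+1)$. Its deviation function is $\delta_{q,\alpha}(\omega,x)=F_{q,\alpha}(\omega,x)-x$,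 which is 1-periodic in $x$, so $\delta_{q,\alpha}(\omega,p^{-1}(s))$ is well defined for $s\in S^1$. Put $F^n(\omega,x)=F_{q,\alpha}(\theta^{n-1}\omega,\cdot)\circ\cdots\circ F_{q,\alpha}(\theta\omega,\cdot)\circ F_{q,\alpha}(\omega,x)$. An invariant probability measure $\mu$ for $\Theta$ on $\Omega\times S^1$ is understood to have marginal $\mathbb P$ on $\Omega$ and to be disintegrated as $\mu(d\omega,ds)=\nu_\omega(ds)\,\mathbb P(d\omega)$, where $\nu_\omega$ are random probability measures on $S^1$. $\mathbb E$ is expectation with respect to $\mathbb P$. *)

(* Defs.v *)
From HB Require Import structures.
From mathcomp Require Import all_boot all_order all_algebra.
From mathcomp Require Import all_classical all_reals all_analysis.

Set Implicit Arguments.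
Unset Strict Implicit.
Unset Printing Implicit Defensive.

Import Order.TTheory GRing.Theory Num.Theory.
Import numFieldNormedType.Exports.

Local Open Scope classical_set_scope.
Local Open Scope ring_scope.

(* The complex plane is represented by R * R, so that e^{2 pi i x} is the pair
   (cos (2 pi x), sin (2 pi x)). *)
Definition circle (R : realType) : set (R * R) :=
  [set z | z.1 ^+ 2 + z.2 ^+ 2 = 1].

Definition S1 (R : realType) : Type := set_type (@circle R).

Lemma circle_cos_sin (R : realType) (x : R) :
  (cos (2 * pi * x), sin (2 * pi * x)) \in @circle R.
Proof. by apply/mem_set; rewrite /circle /= cos2Dsin2. Qed.

Definition covering (R : realType) (x : R) : S1 R :=
  exist _ (cos (2 * pi * x), sin (2 * pi * x)) (circle_cos_sin x).

Section circle_structures.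
Variable R : realType.

HB.instance Definition _ := Choice.on (S1 R).
HB.instance Definition _ := isPointed.Build (S1 R) (covering 0).
HB.instance Definition _ := Uniform.copy (S1 R) (set_type (@circle R)).
HB.instance Definition _ := Measurable.copy (S1 R)
  (g_sigma_algebraType (@open (S1 R))).

End circle_structures.

Definition homeomorphism (T U : topologicalType) (g : T -> U) : Prop :=
  continuous g /\
  exists2 h : U -> T, continuous h & cancel g h /\ cancel h g.

Definition is_lift (R : realType) (g : S1 R -> S1 R) (G : R -> R) : Prop :=
  [/\ {homo G : x y / x < y}, continuous G
    & forall x, covering (G x) = g (covering x)].

(* A homeomorphism of the circle preserves orientation when its lifts to the
   line are increasing (they are decreasing otherwise). *)
Definition orientation_preserving (R : realType) (g : S1 R -> S1 R) : Prop :=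
  exists G : R -> R, is_lift g G.

(* H^+ carries the topology of uniform convergence and its Borel
   sigma-algebra. *)
Definition Hplus_set (R : realType) : set {uniform S1 R -> S1 R} :=
  [set g | homeomorphism (g : S1 R -> S1 R) /\
           orientation_preserving (g : S1 R -> S1 R)].

Definition Hplus (R : realType) : Type := set_type (@Hplus_set R).

Definition Hplus_fun (R : realType) (g : Hplus R) : S1 R -> S1 R := \val g.
Coercion Hplus_fun : Hplus >-> Funclass.

Lemma Hplus_id (R : realType) : (@id (S1 R)) \in @Hplus_set R.
Proof.
apply/mem_set; split; last by exists id; split => // x; exact: cvg_id.
by split; [move=> x; exact: cvg_id | exists id => // x; exact: cvg_id].
Qed.

Section Hplus_structures.
Variable R : realType.

HB.instance Definition _ := Choice.on (Hplus R).
HB.instance Definition _ := isPointed.Build (Hplus R)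
  (exist _ (@id (S1 R)) (Hplus_id R)).
HB.instance Definition _ := Uniform.copy (Hplus R) (set_type (@Hplus_set R)).
HB.instance Definition _ := Measurable.copy (Hplus R)
  (g_sigma_algebraType (@open (Hplus R))).

End Hplus_structures.

(* The lift F_{q,alpha} of g; it exists and is unique for g in H^+, so the
   default value is never used. *)
Definition normalized_lift (R : realType) (q alpha : R) (g : Hplus R) : R -> R :=
  xget (idfun : R -> R) [set G | is_lift g G /\ alpha <= G q < alpha + 1].

Definition deviation (R : realType) (G : R -> R) (x : R) : R := G x - x.

(* phi (p^{-1}(s)): meaningful for a 1-periodic phi, the value then being
   independent of the chosen preimage of s. *)
Definition on_circle (R : realType) (phi : R -> R) (s : S1 R) : R :=
  phi (xget 0 [set x | covering x = s]).

Definition measure_preserving d (T : measurableType d) (R : realType)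
    (P : probability T R) (theta : T -> T) : Prop :=
  measurable_fun [set: T] theta /\
  forall A, measurable A -> pushforward P theta A = P A.

Definition ergodic d (T : measurableType d) (R : realType)
    (P : probability T R) (theta : T -> T) : Prop :=
  forall A, measurable A -> theta @^-1` A = A -> P A = 0%E \/ P A = 1%E.

Definition skew_product (Omega : Type) (R : realType) (theta : Omega -> Omega)
    (f : Omega -> Hplus R) (z : Omega * S1 R) : Omega * S1 R :=
  (theta z.1, f z.1 z.2).

Definition skew_invariant d (Omega : measurableType d) (R : realType)
    (P : probability Omega R) (theta : Omega -> Omega) (f : Omega -> Hplus R)
    (mu : probability (Omega * S1 R)%type R) : Prop :=
  (forall A, measurable A -> pushforward mu (skew_product theta f) A = mu A) /\
  (forall E, measurable E -> pushforward mu fst E = P E).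

(* mu(dw, ds) = nu_w(ds) P(dw) *)
Definition disintegration d (Omega : measurableType d) (R : realType)
    (P : probability Omega R) (mu : probability (Omega * S1 R)%type R)
    (nu : R.-pker Omega ~> S1 R) : Prop :=
  forall A, measurable A -> mu A = (\int[P]_w nu w (xsection A w))%E.

(* F^n(w, x) for the cocycle generated by F over theta *)
Fixpoint cocycle (Omega : Type) (R : realType) (theta : Omega -> Omega)
    (F : Omega -> R -> R) (n : nat) (w : Omega) (x : R) : R :=
  if n is m.+1 then F (iter m theta w) (cocycle theta F m w x) else x.

Definition is_rotation_number (Omega : Type) (R : realType)
    (theta : Omega -> Omega) (f : Omega -> Hplus R) (q alpha : R) (w : Omega)
    (rho : R) : Prop :=
  let F := fun w' => normalized_lift q alpha (f w') in
  forall x : R, (cocycle theta F n w x - x) / n%:R @[n --> \oo] --> rho.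

(* Main.v *)
Require Import Defs.
From HB Require Import structures.
From mathcomp Require Import all_boot all_order all_algebra.
From mathcomp Require Import all_classical all_reals all_analysis.
From mathcomp Require Import measurable_realfun.
From mathcomp Require Import ring lra zify.

Set Implicit Arguments.
Unset Strict Implicit.
Unset Printing Implicit Defensive.

Import Order.TTheory GRing.Theory Num.Theory.
Import numFieldNormedType.Exports.

Local Open Scope classical_set_scope.
Local Open Scope ring_scope.

(** The displacement F^n(w, x) - x is the Birkhoff sum of the deviation g along
    the orbit of (w, p x) under the skew product, and changing x alters it by at
    most 1. Let I be the integral of g with respect to mu. For c > I, the set of
    w with sup_n (F^n(w, q) - q - n c) = +oo is theta-invariant, so it has
    probability 0 or 1. If it had probability 1, then by the bound on the
    oscillation in x some Birkhoff sum of g - c would be positive mu-almost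
    everywhere, and the maximal ergodic theorem would give I >= c. Hence
    F^n(w, q) - q <= n c + K(w) almost surely; the same for c < I with the
    opposite sign shows that the rotation number is I. *)

(** * The covering map of the circle *)

(** For the forward direction let [t] be the fractional part of [y - x]. The subtraction formula
    gives cos (2 pi t) = 1, that is sin (pi t) = 0, while sin (pi t) > 0 for 0 < t < 1; hence
    [t = 0]. *)
Lemma covering_eqP (R : realType) (x y : R) :
  covering x = covering y <-> exists m : int, y = x + m%:~R.
Proof.
have per (z : R) (n : nat) : covering (z + n%:R) = covering z.
  have e : 2 * pi * (z + n%:R) = 2 * pi * z + (pi *+ 2) *+ n :> R.
    by rewrite -[_ *+ n]mulr_natr -[pi *+ 2]mulr_natr; ring.
  apply/val_inj; rewrite /= e periodicn ?periodicn//.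
    exact: sinD2pi.
  exact: cosD2pi.
have perz (z : R) (m : int) : covering (z + m%:~R) = covering z.
  case: m => n; first exact: per.
  by rewrite -[in RHS](subrK (n.+1%:R : R) z) per NegzE mulrNz.
split => [|[m ->]]; last by rewrite perz.
move=> exy; exists (Num.floor (y - x)).
set m := Num.floor _; set t := y - x - m%:~R.
have := floor_itv (y - x); rewrite -/m => /andP[m1 m2].
have t0 : 0 <= t by rewrite /t; lra.
have t1 : t < 1 by move: m2; rewrite intrD /t; lra.
suff : t = 0 by rewrite /t => /eqP; rewrite subr_eq0 => /eqP; lra.
have [sx cx] : sin (2 * pi * x) = sin (2 * pi * y) /\
    cos (2 * pi * x) = cos (2 * pi * y).
  by move: exy => /(congr1 val) /= [].
have ct : cos (2 * pi * t) = 1.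
  have <- : cos (2 * pi * (y - x)) = cos (2 * pi * t).
    have := perz t m; rewrite /t subrK => /(congr1 val) /= [<- _//].
  rewrite mulrBr cosB cx sx -!expr2; exact: cos2Dsin2.
apply/eqP; apply: contraT => tn0.
have tgt0 : 0 < t by rewrite lt0r tn0.
have : 0 < sin (pi * t).
  apply: sin_gt0_pi; rewrite mulr_gt0 ?pi_gt0//=.
  by rewrite gtr_pMr ?pi_gt0.
have : cos (2 * pi * t) = 1 - (sin (pi * t) ^+ 2) *+ 2.
  rewrite (_ : 2 * pi * t = pi * t *+ 2); last by rewrite -mulr_natr; ring.
  by rewrite cos_mulr2n cos2sin2 mulrnBl; ring.
rewrite ct => e s0.
have : sin (pi * t) ^+ 2 = 0 by move: e; rewrite mulr2n; lra.
by move/eqP; rewrite sqrf_eq0 gt_eqF.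
Qed.

Lemma covering_surj (R : realType) (c : R) (s : S1 R) :
  exists2 x, c <= x < c + 1 & covering x = s.
Proof.
suff [y ys] : exists y : R, covering y = s.
  exists (y + (- Num.floor (y - c))%:~R).
    have := floor_itv (y - c); move=> /andP[].
    by rewrite intrD mulrNz => ? ?; apply/andP; split; lra.
  by rewrite -ys; apply/esym/covering_eqP; eexists.
have pi0 : (pi : R) != 0 by rewrite gt_eqF// pi_gt0.
case: s => -[a b] sP; have /= ab := set_mem sP; rewrite /circle /= in ab.
have a1 : -1 <= a <= 1 by have := sqr_ge0 b; move=> h; apply/andP; split; nra.
have ca : cos (acos a) = a by apply: acosK; rewrite in_itv.
have sa : sin (acos a) = `|b|.
  by rewrite sin_acos// -sqrtr_sqr -ab; congr Num.sqrt; ring.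
have [b0|b0] := leP 0 b.
  (* The angle [acos a] has sine [|b|], so the sign of [b] decides between this angle and its
     opposite. *)
  exists (acos a / (2 * pi)); apply/val_inj => /=.
  rewrite mulrC divfK ?mulf_neq0 ?pnatr_eq0// ca sa ger0_norm//.
exists (- (acos a / (2 * pi))); apply/val_inj => /=.
rewrite mulrN mulrC divfK ?mulf_neq0 ?pnatr_eq0// cosN sinN ca sa ltr0_norm//.
by rewrite opprK.
Qed.

Lemma covering_val_continuous (R : realType) :
  continuous (fun x : R => set_val (covering x)).
Proof.
have c2 : continuous (fun x : R => 2 * pi * x).
  exact: mulrl_continuous.
move=> x; exact: (@cvg_pair _ _ _ (nbhs x) _ _ _ _ _ _ _
  (@continuous_comp _ _ _ (fun x : R => 2 * pi * x) cos x (c2 x)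
    (@continuous_cos _ _))
  (@continuous_comp _ _ _ (fun x : R => 2 * pi * x) sin x (c2 x)
    (@continuous_sin _ _))).
Qed.

Lemma covering_continuous (R : realType) : continuous (@covering R).
Proof.
exact: (@continuous_comp_initial (S1 R) R (R * R)%type set_val (@covering R)
  (@covering_val_continuous R)).
Qed.

(** * Lifts of circle homeomorphisms *)

Section lifts.
Variables (R : realType) (g : Hplus R) (G : R -> R).
Hypothesis liftG : is_lift g G.

Let Glt : {homo G : x y / x < y}. Proof. by case: liftG. Qed.
Let Gcont : continuous G. Proof. by case: liftG. Qed.
Let GE x : covering (G x) = g (covering x). Proof. by case: liftG. Qed.

Lemma lift_le : {homo G : x y / x <= y}.
Proof.
by move=> x y; rewrite le_eqVlt => /predU1P[->//|/Glt/ltW].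
Qed.

(* The integer G (x + 1) - G x is positive; were it at least 2, G would take the
   value G x + 1 inside (x, x + 1), contradicting the injectivity of g. *)
Lemma liftD1 x : G (x + 1) = G x + 1.
Proof.
have /covering_eqP[m em] : covering (G x) = covering (G (x + 1)).
  by rewrite !GE; congr (g _); apply/covering_eqP; exists 1.
have lt01 : G x < G (x + 1) by apply: Glt; lra.
have m0 : (0 < m)%R by rewrite -(ltr0z R); lra.
have [m1|m1] := leP m 1%R; first by rewrite em (_ : m = 1)//; lia.
have m2 : 2 <= m%:~R :> R by rewrite (_ : 2 = 2%:~R)// ler_int; lia.
have [y yx /eqP] : exists2 y, y \in `[x, x + 1] & G y = G x + 1.
  apply: IVT; first lra.
    by apply: continuous_subspaceT => z; exact: Gcont.
  by rewrite min_l ?max_r ?(ltW lt01)//; lra.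
move=> /eqP ey; have /covering_eqP[k ek] : covering x = covering y.
  have [_ [h _ [gK _]]] : homeomorphism (g : S1 R -> S1 R).
    by have [] := set_mem (valP g).
  rewrite -[LHS]gK -[RHS]gK; congr (h _).
  by rewrite -/(Hplus_fun g) -!GE; apply/covering_eqP; exists 1; rewrite ey.
move: yx; rewrite in_itv /= => /andP[yx0 yx1].
have xy : x < y.
  by rewrite lt_neqAle yx0 andbT; apply: contra_eq_neq ey => <-; lra.
have yx : y < x + 1.
  by rewrite lt_neqAle yx1 andbT; apply: contra_eq_neq ey => ->; lra.
have k0 : (0 < k)%R by rewrite -(ltr0z R); lra.
have k1 : (k < 1)%R by rewrite -(ltrz1 R); lra.
lia.
Qed.

Lemma liftDz x (m : int) : G (x + m%:~R) = G x + m%:~R.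
Proof.
have liftDn z (n : nat) : G (z + n%:R) = G z + n%:R.
  elim: n z => [|n IH] z; first by rewrite !addr0.
  by rewrite -natr1 addrA liftD1 IH addrA.
case: m => n; first exact: liftDn.
by rewrite NegzE mulrNz; apply/eqP; rewrite -subr_eq opprK -liftDn subrK.
Qed.

End lifts.

(** Translating any lift [G] by minus the floor of [G q - alpha] puts its value at [q] in the
    required window, so the default of [xget] is never reached. *)
Lemma normalized_liftP (R : realType) (q alpha : R) (g : Hplus R) :
  is_lift g (normalized_lift q alpha g) /\
  alpha <= normalized_lift q alpha g q < alpha + 1.
Proof.
have [_ [G [Glt Gc GE]]] := set_mem (valP g).
apply: (@xgetPex _ (idfun : R -> R)
  [set G | is_lift g G /\ alpha <= G q < alpha + 1]).
exists (fun x => G x + (- Num.floor (G q - alpha))%:~R); split; last first.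
  have := floor_itv (G q - alpha); move=> /andP[].
  by rewrite intrD mulrNz => ? ?; apply/andP; split; lra.
split => [x y xy|x|x].
- by rewrite ltrD2r Glt.
- by apply: continuousD; [exact: Gc|exact: cvg_cst].
- transitivity (covering (G x)); last exact: GE.
  by apply/esym/covering_eqP; eexists.
Qed.

Lemma on_circle_covering (R : realType) (phi : R -> R) (x : R) :
  (forall z (m : int), phi (z + m%:~R) = phi z) ->
  on_circle phi (covering x) = phi x.
Proof.
move=> per; rewrite /on_circle.
have /esym/covering_eqP[m ->] :
    covering (xget 0 [set y | covering y = covering x]) = covering x.
  by apply: (@xgetPex _ 0 [set y | covering y = covering x]); exists x.
by rewrite per.
Qed.

(** * Measurability of evaluations, angles and lifts *)

Lemma measurable_covering (R : realType) : measurable_fun setT (@covering R).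
Proof.
apply: (measurability (@open (S1 R))) => // _ [A oA <-].
rewrite setTI; apply: open_measurable.
by apply: open_comp => // x _; exact: covering_continuous.
Qed.

(** Uniform convergence implies pointwise convergence, so evaluation at [s] is continuous on
    [Hplus R], hence Borel. *)
Lemma measurable_Hplus_eval (R : realType) (s : S1 R) :
  measurable_fun setT (fun g : Hplus R => (g : S1 R -> S1 R) s).
Proof.
apply: (measurability (@open (S1 R))) => // _ [A oA <-].
rewrite setTI; apply: sub_sigma_algebra.
apply: open_comp => // g _.
apply: (@continuous_comp (Hplus R) {uniform S1 R -> S1 R} _ set_val
  (fun h => h s)).
  exact: initial_continuous.
have /pointwise_uniform_cvg :
    {uniform, nbhs (set_val g : {uniform S1 R -> S1 R}) -->
      (set_val g : S1 R -> S1 R)}.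
  exact: cvg_id.
by move=> /pointwise_cvgP; exact.
Qed.

Definition angle (R : realType) (c : R) (s : S1 R) : R :=
  xget c [set x | c <= x < c + 1 /\ covering x = s].

Section angle.
Variables (R : realType) (c : R).

Lemma angleP (s : S1 R) : c <= angle c s < c + 1 /\ covering (angle c s) = s.
Proof.
apply: (@xgetPex _ c [set x | c <= x < c + 1 /\ covering x = s]).
by have [x cx xs] := covering_surj c s; exists x.
Qed.

Lemma angle_unique (s : S1 R) (x : R) :
  c <= x < c + 1 -> covering x = s -> angle c s = x.
Proof.
move=> /andP[cx xc] xs; have [/andP[ca ac] as_] := angleP s.
have /covering_eqP[m em] : covering x = covering (angle c s) by rewrite xs.
have m1 : (m < 1)%R by rewrite -(ltrz1 R); lra.
have m0 : (-1 < m)%R by rewrite -(ltr_int R) mulrNz; lra.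
by rewrite em (_ : m = 0) ?addr0//; lia.
Qed.

(* [angle] is discontinuous, but its sublevel sets are images of compact
   segments, hence closed. *)
Lemma measurable_angle : measurable_fun setT (angle c).
Proof.
apply: (measurability _ (RGenOInfty.measurableE R)).
move=> _ [_ [y ->] <-]; rewrite setTI -[X in measurable X]setCK.
apply: measurableC.
have [yc|cy] := ltP y c.
  rewrite (_ : ~` _ = set0); first exact: measurable0.
  rewrite -subset0 => s /=; have [/andP[ca _] _] := angleP s.
  by rewrite in_itv /= andbT; apply; lra.
have [cy1|yc1] := leP (c + 1) y.
  rewrite (_ : ~` _ = setT); first exact: measurableT.
  rewrite -subTset => s /= _; have [/andP[_ ca] _] := angleP s.
  by rewrite in_itv /= andbT; apply/negP; rewrite -leNgt; lra.
rewrite (_ : ~` _ =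
    set_val @^-1` ((fun x : R => set_val (covering x)) @` `[c, y])).
  rewrite -[X in measurable X]setCK; apply: measurableC.
  apply: sub_sigma_algebra; rewrite preimage_setC.
  exists (~` ((fun x : R => set_val (covering x)) @` `[c, y])) => //.
  apply: closed_openC; apply: compact_closed.
    exact: norm_hausdorff.
  apply: continuous_compact; last exact: segment_compact.
  apply: continuous_subspaceT => x; exact: covering_val_continuous.
apply/seteqP; split => s /=.
  have [/andP[ca _] as_] := angleP s.
  rewrite in_itv /= andbT => /negP; rewrite -leNgt => ay.
  by exists (angle c s); rewrite ?in_itv /= ?ca// as_.
move=> [x]; rewrite in_itv /= => /andP[cx xy] xs.
rewrite in_itv /= andbT; apply/negP; rewrite -leNgt.
rewrite (@angle_unique s x)//; first by apply/andP; split; lra.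
exact: val_inj.
Qed.

End angle.

Section measurable_lift.
Variables (R : realType) (q alpha : R).
Local Notation F := (normalized_lift q alpha).

(** By monotonicity and degree one, [F g x] is the preimage of [g (covering x)] in [F g q, F g q +
    1), and [F g q] is itself the angle of [g (covering q)] based at [alpha]. The lift thus depends
    on [g] only through two evaluations, which makes it measurable in [g]. *)
Lemma normalized_liftE (g : Hplus R) (x : R) : q <= x < q + 1 ->
  F g x = if angle alpha (g (covering x)) < angle alpha (g (covering q))
          then angle alpha (g (covering x)) + 1
          else angle alpha (g (covering x)).
Proof.
move=> /andP[qx xq].
have [liftF Fq] := normalized_liftP q alpha g.
have [_ _ Fcov] := liftF.
rewrite (@angle_unique _ alpha (g (covering q)) (F g q))//.
have F1 : F g q <= F g x by apply: (lift_le liftF).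
have F2 : F g x < F g q + 1 by rewrite -(liftD1 liftF); case: liftF => + _ _; apply.
have [/andP[av va] vs] := angleP alpha (g (covering x)).
move: (angle _ _) av va vs => v av va; rewrite -Fcov => /covering_eqP[m em].
case/andP: Fq => F3 F4.
case: ltP => vF.
  have m0 : (0 < m)%R by rewrite -(ltr_int R); lra.
  have m2 : (m < 2)%R by rewrite -(ltr_int R); lra.
  by rewrite em (_ : m = 1)//; lia.
have m0 : (-1 < m)%R by rewrite -(ltr_int R) mulrNz; lra.
have m2 : (m < 1)%R by rewrite -(ltr_int R); lra.
by rewrite em (_ : m = 0) ?addr0//; lia.
Qed.

Lemma measurable_normalized_lift (x : R) : measurable_fun setT (F ^~ x).
Proof.
(* A lift commutes with integer translations, so [x] may be moved into [q, q + 1), where the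
   explicit formula applies. *)
have [y qy /covering_eqP[m ->]] := covering_surj q (covering x).
rewrite (_ : F ^~ _ = fun g => F g y + m%:~R); last first.
  by apply/funext => g; rewrite (liftDz (normalized_liftP q alpha g).1).
apply: measurable_funD => //.
rewrite (_ : F ^~ _ = fun g =>
    if angle alpha (g (covering y)) < angle alpha (g (covering q))
    then angle alpha (g (covering y)) + 1
    else angle alpha (g (covering y))); last first.
  by apply/funext => g; rewrite normalized_liftE.
have ma z : measurable_fun setT (fun g : Hplus R => angle alpha (g z)).
  by apply: measurableT_comp (measurable_Hplus_eval z); exact: measurable_angle.
apply: measurable_fun_ifT => //.
  exact: measurable_fun_ltr.
exact: measurable_funD.
Qed.

End measurable_lift.

(** The set where h t x < y is the union over rationals r of {t | h t r < y} times ]-oo, r]: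
    continuity provides a rational r > x with h t r < y, and monotonicity gives the converse
    inclusion. *)
Lemma measurable_nondecreasing_continuous d (T : measurableType d)
    (R : realType) (h : T -> R -> R) :
  (forall x, measurable_fun setT (h ^~ x)) ->
  (forall t, {homo h t : x y / x <= y}) -> (forall t, continuous (h t)) ->
  measurable_fun setT (fun z : T * R => h z.1 z.2).
Proof.
move=> mh hle hc.
apply: (measurability _ (RGenInftyO.measurableE R)).
move=> _ [_ [y ->] <-]; rewrite setTI.
rewrite (_ : _ @^-1` _ = \bigcup_(r : rat)
    ((h ^~ (ratr r) @^-1` `]-oo, y[) `*` `]-oo, (ratr r : R)])).
  apply: bigcupT_measurable_rat => r; apply: measurableX => //.
  by rewrite -[X in measurable X]setTI; exact: mh.
apply/seteqP; split => -[t x] /=; last first.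
  move=> [r _ [/=]]; rewrite !in_itv /= => hr xr.
  by apply: le_lt_trans hr; exact: hle.
rewrite in_itv /= => hy.
have /nbhs_ballP[e /= e0 eP] : nbhs x (h t @^-1` `]-oo, y[).
  by apply: hc; apply: open_nbhs_nbhs; split; [exact: interval_open|rewrite /= in_itv].
have [r] := @rat_in_itvoo _ x (x + e) ltac:(by rewrite ltrDl).
rewrite in_itv /= => /andP[xr re]; exists r => //; split => /=.
  apply: (eP (ratr r)); rewrite /ball /= distrC ger0_norm; lra.
by rewrite in_itv /= ltW.
Qed.

(** * Birkhoff sums and the maximal ergodic theorem *)

Definition birkhoff_sum (X : Type) (R : realType) (T : X -> X) (h : X -> R)
    (n : nat) (x : X) : R :=
  \sum_(k < n) h (iter k T x).

Lemma birkhoff_sumS (X : Type) (R : realType) (T : X -> X) (h : X -> R)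
    (n : nat) (x : X) :
  birkhoff_sum T h n.+1 x = h x + birkhoff_sum T h n (T x).
Proof.
rewrite /birkhoff_sum big_ord_recl; congr (_ + _); apply: eq_bigr => k _.
by rewrite -iterSr.
Qed.

Lemma measurable_iter d (X : measurableType d) (T : X -> X) (n : nat) :
  measurable_fun setT T -> measurable_fun setT (iter n T).
Proof.
move=> mT; elim: n => [|n IH]; first exact: measurable_id.
exact: measurableT_comp mT IH.
Qed.

Lemma measurable_birkhoff_sum d (X : measurableType d) (R : realType)
    (T : X -> X) (h : X -> R) (n : nat) :
  measurable_fun setT T -> measurable_fun setT h ->
  measurable_fun setT (birkhoff_sum T h n).
Proof.
move=> mT mh; apply: measurable_sum => k.
by apply: measurableT_comp mh _; exact: measurable_iter.
Qed.

(** Stated for finite measures, so that it also covers the measures [nu w] of a probability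
    kernel. *)
Lemma finite_measure_integrable d (X : measurableType d) (R : realType)
    (m : {measure set X -> \bar R}) (h : X -> R) (C : R) :
  (m setT < +oo)%E -> measurable_fun setT h -> (forall x, `|h x| <= C) ->
  m.-integrable setT (EFin \o h).
Proof.
move=> moo mh hC; apply: measurable_bounded_integrable => //.
exists C; split; first exact: num_real.
by move=> y Cy x _ /=; apply: le_trans (hC x) (ltW Cy).
Qed.

Section bounded_functions.
Context d (X : measurableType d) (R : realType) (mu : probability X R).

Lemma integrable_bounded (h : X -> R) (C : R) :
  measurable_fun setT h -> (forall x, `|h x| <= C) ->
  mu.-integrable setT (EFin \o h).
Proof.
apply: finite_measure_integrable.
by rewrite [X in (X < _)%E]probability_setT ltry.
Qed.

Lemma Rintegral_comp (T : X -> X) (h : X -> R) :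
  measure_preserving mu T -> measurable_fun setT h ->
  mu.-integrable setT (EFin \o (fun x => h (T x))) ->
  \int[mu]_x h (T x) = \int[mu]_x h x.
Proof.
move=> [mT Tmu] mh ih; rewrite /Rintegral; congr fine.
have mEh : measurable_fun setT (EFin \o h) by exact/measurable_EFinP.
have := @integral_pushforward _ _ _ _ _ _ mT mu setT (EFin \o h) mEh ih
  measurableT.
rewrite preimage_setT => <-.
by apply: eq_measure_integral => A mA _; exact: Tmu.
Qed.

Section maximal_ergodic.
Variables (T : X -> X) (h : X -> R) (C : R).
Hypotheses (Tmu : measure_preserving mu T) (mh : measurable_fun setT h).
Hypothesis (hC : forall x, `|h x| <= C).

(* The maximum of the Birkhoff sums of order at most [n]. *)
Fixpoint max_sum (n : nat) (x : X) : R :=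
  if n is m.+1 then Num.max 0 (h x + max_sum m (T x)) else 0.

Let mT : measurable_fun setT T. Proof. by case: Tmu. Qed.

Lemma measurable_max_sum n : measurable_fun setT (max_sum n).
Proof.
elim: n => [|n IH] /=; first exact: measurable_cst.
apply: measurable_maxr; first exact: measurable_cst.
by apply: measurable_funD => //; exact: measurableT_comp.
Qed.

Lemma max_sum_ge0 n x : 0 <= max_sum n x.
Proof. by case: n => [|n] //=; rewrite le_max lexx. Qed.

Lemma max_sum_bounded n x : `|max_sum n x| <= n%:R * C.
Proof.
rewrite ger0_norm ?max_sum_ge0//.
have C0 : 0 <= C by apply: le_trans (hC x).
elim: n x => [|n IH] x /=; first by rewrite mul0r.
rewrite ge_max mulr_ge0//= -natr1 mulrDl mul1r addrC lerD//.
by apply: le_trans (hC x); exact: ler_norm.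
Qed.

Lemma max_sum_nondecreasing x : {homo max_sum ^~ x : m n / (m <= n)%N >-> m <= n}.
Proof.
apply: homo_leq => //; first by move=> ? ? ?; exact: le_trans.
move=> n; elim: n x => [|n IH] x /=; first by rewrite le_max lexx.
by rewrite le_max2//= lerD2l IH.
Qed.

Lemma birkhoff_sum_le_max n x : birkhoff_sum T h n x <= max_sum n x.
Proof.
elim: n x => [|n IH] x; first by rewrite /birkhoff_sum big_ord0.
by rewrite birkhoff_sumS /= le_max lerD2l IH orbT.
Qed.

Let A n : set X := [set x | 0 < max_sum n x].

Let mA n : measurable (A n).
Proof.
rewrite /A (_ : mkset _ = max_sum n @^-1` `]0, +oo[).
  by rewrite -[X in measurable X]setTI; apply: measurable_max_sum.
by apply/seteqP; split => x /=; rewrite in_itv /= andbT.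
Qed.

Let hA_bounded n x : `|h x * \1_(A n) x| <= C.
Proof.
rewrite normrM; apply: le_trans (hC x); rewrite ler_piMr//.
by rewrite indicE; case: (_ \in _); rewrite ?normr1 ?normr0.
Qed.

Let mhA n : measurable_fun setT (fun x => h x * \1_(A n) x).
Proof. by apply: measurable_funM => //; exact: measurable_indic. Qed.

(* Garsia's argument: [h >= max_sum n.+1 - max_sum n \o T] where [max_sum n.+1]
   is positive. *)
Lemma max_sum_integral_ge0 n : 0 <= \int[mu]_x (h x * \1_(A n.+1) x).
Proof.
have iM k := integrable_bounded (measurable_max_sum k) (max_sum_bounded k).
have iMT k : mu.-integrable setT (EFin \o (fun x => max_sum k (T x))).
  apply: (@integrable_bounded _ (k%:R * C)).
    by apply: measurableT_comp => //; exact: measurable_max_sum.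
  by move=> x; exact: max_sum_bounded.
(* The integral of this difference is nonnegative: by invariance [max_sum n] and its composition
   with [T] have the same integral, and [max_sum n <= max_sum n.+1]. *)
apply: (@le_trans _ _ (\int[mu]_x (max_sum n.+1 x - max_sum n (T x)))).
  rewrite RintegralB// ?(Rintegral_comp Tmu (measurable_max_sum n) (iMT n))//.
  rewrite subr_ge0; apply: le_Rintegral => // x _.
  exact: max_sum_nondecreasing.
apply: le_Rintegral => //.
- rewrite (_ : _ \o _ =
    (EFin \o max_sum n.+1) \- (EFin \o (fun x => max_sum n (T x))))%E//.
  exact: integrableB.
- exact: integrable_bounded (mhA n.+1) (hA_bounded n.+1).
move=> x _; rewrite indicE; case: (boolP (x \in A n.+1)).
  rewrite inE /A /= lt_max ltxx /= => h0.
  by rewrite max_r ?(ltW h0)// mulr1 addrK.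
(* Off [A n.+1] the first maximum vanishes and the subtracted one is nonnegative. *)
move=> xA; rewrite mulr0 subr_le0.
have : max_sum n.+1 x <= 0.
  by rewrite leNgt; apply: contra xA => ?; rewrite inE.
by move=> /le_trans; apply; exact: max_sum_ge0.
Qed.

(** The sets [A n] increase to a set of full measure, so the nonnegative integrals of [h] over them
    converge to the integral of [h], by domination by the constant [C]. *)
Lemma maximal_ergodic :
  {ae mu, forall x, exists n, 0 < birkhoff_sum T h n x} ->
  0 <= \int[mu]_x h x.
Proof.
move=> pos.
have mEh : measurable_fun setT (EFin \o h) by exact/measurable_EFinP.
have hAh : {ae mu, forall x, setT x ->
    (h x * \1_(A n.+1) x)%:E @[n --> \oo] --> (h x)%:E}.
  apply: filterS pos => x [n n0] _.
  apply: cvg_near_cst; exists n => // m /= nm.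
  rewrite indicE mem_set ?mulr1//.
  apply: lt_le_trans n0 _; apply: le_trans (birkhoff_sum_le_max n x) _.
  exact: (@max_sum_nondecreasing x n m.+1 (leqW nm)).
have iC : mu.-integrable setT (EFin \o cst C).
  by apply: (@integrable_bounded _ `|C|).
have [_ _ cvgI] := @dominated_convergence _ _ _ mu setT measurableT
  (fun n x => (h x * \1_(A n.+1) x)%:E) (EFin \o h) (EFin \o cst C)
  (fun n => (measurable_EFinP _ _).2 (mhA n.+1)) mEh hAh iC
  (aeW _ (fun x n _ => hA_bounded n.+1 x)).
rewrite /Rintegral fine_ge0// -(cvg_lim _ cvgI)//.
apply: lime_ge; first by apply/cvg_ex; eexists; exact: cvgI.
apply: nearW => n.
have := max_sum_integral_ge0 n.
rewrite /Rintegral -lee_fin fineK//.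
apply: integrable_fin_num => //.
exact: integrable_bounded (mhA n.+1) (hA_bounded n.+1).
Qed.

End maximal_ergodic.
End bounded_functions.

(** * Zero-one law for unbounded Birkhoff sums *)

Section unbounded_set.
Variables (R : realType) (Omega : Type).

(** Thresholds are natural numbers so that the event is a countable intersection of countable
    unions, hence measurable. *)
Definition unbounded_above (a : nat -> Omega -> R) : set Omega :=
  [set w | forall K : nat, exists n, K%:R < a n w].

Lemma unbounded_above_invariant (theta : Omega -> Omega)
    (a : nat -> Omega -> R) (B : R) :
  (forall w, a 0 w = 0) ->
  (forall n w, `|a n.+1 w - a n (theta w)| <= B) ->
  theta @^-1` unbounded_above a = unbounded_above a.
Proof.
move=> a0 aB; apply/seteqP; split => w /= aw K; last first.
  (* This threshold exceeds [K + B], so the value stays above [K] after a loss of at most [B]. Being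
     positive, it also excludes the index 0, where [a] vanishes. *)
  have [[|n]] := aw (K + Num.truncn B).+1; first by rewrite a0 ltNge ler0n.
  move=> nK; exists n; have := aB n w; rewrite ler_distl => /andP[_].
  have := truncnS_gt B.
  by move: nK; rewrite -natr1 -[_.+1%:R in X in _ -> X]natr1 natrD; lra.
have [n nK] := aw (K + Num.truncn B).+1.
exists n.+1; have := aB n w; rewrite ler_distl => /andP[+ _].
have := truncnS_gt B.
by move: nK; rewrite -natr1 -[_.+1%:R in X in _ -> X]natr1 natrD; lra.
Qed.

End unbounded_set.

Lemma measurable_unbounded_above (R : realType) d (Omega : measurableType d)
    (a : nat -> Omega -> R) :
  (forall n, measurable_fun setT (a n)) -> measurable (unbounded_above a).
Proof.
move=> ma; rewrite (_ : unbounded_above a =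
    \bigcap_(K : nat) \bigcup_(n : nat) (a n @^-1` `]K%:R, +oo[)).
  apply: bigcapT_measurable => K; apply: bigcup_measurable => n _.
  by rewrite -[X in measurable X]setTI; exact: ma.
apply/seteqP; split => w aw K.
  by move=> _; have [n nK] := aw K; exists n => //=; rewrite in_itv /= nK.
by have [n _] := aw K I; rewrite /= in_itv /= andbT => nK; exists n.
Qed.

(** Only the base map [theta] is ergodic, so the event has to live on [Omega]: it is read at the
    single point [s0], and the oscillation bound [D] carries it over to all other points of the
    fibre. *)
Lemma birkhoff_sum_bounded_above d d' (Omega : measurableType d)
    (S : measurableType d') (R : realType) (P : probability Omega R)
    (mu : probability (Omega * S)%type R) (theta : Omega -> Omega)
    (T : Omega * S -> Omega * S) (h : Omega * S -> R) (C D : R) (s0 : S) :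
  ergodic P theta -> measure_preserving mu T ->
  (forall A, measurable A -> pushforward mu fst A = P A) ->
  (forall z, (T z).1 = theta z.1) ->
  measurable_fun setT h -> (forall z, `|h z| <= C) ->
  (forall n w s s',
    `|birkhoff_sum T h n (w, s) - birkhoff_sum T h n (w, s')| <= D) ->
  \int[mu]_z h z < 0 ->
  {ae P, forall w, exists K : nat, forall n, birkhoff_sum T h n (w, s0) <= K%:R}.
Proof.
move=> Perg muT muP T1 mh hC osc int_lt0.
pose a n w := birkhoff_sum T h n (w, s0).
have mE : measurable (unbounded_above a).
  apply: measurable_unbounded_above => n.
  apply: measurableT_comp (measurable_birkhoff_sum n muT.1 mh) _.
  exact: measurable_fun_pair.
have [|PE|PE] := Perg _ mE.
(* [C] bounds the first term of the sum, and [D] the replacement of the second component of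
   [T (w, s0)] by [s0]. *)
- apply: (@unbounded_above_invariant _ _ _ _ (C + D)).
    by move=> w; rewrite /a /birkhoff_sum big_ord0.
  move=> n w; rewrite /a birkhoff_sumS (surjective_pairing (T (w, s0))) T1 /=.
  by rewrite -addrA; apply: le_trans (ler_normD _ _) _; exact: lerD.
- have : P.-negligible (unbounded_above a) by apply/negligibleP.
  apply: negligibleS => w /= nb K; apply: contrapT => nK; apply: nb.
  exists K => n; rewrite leNgt; apply/negP => Kn; apply: nK; by exists n.
- exfalso; have : 0 <= \int[mu]_z h z; last by rewrite leNgt int_lt0.
  apply: (maximal_ergodic muT mh hC).
  pose F : set (Omega * S) := fst @^-1` unbounded_above a.
  have mF : measurable F.
    by rewrite -[X in measurable X]setTI; exact: measurable_fst.
  have muF : mu F = 1%E by rewrite -PE -muP.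
  have : mu.-negligible (~` F).
    apply/negligibleP; first exact: measurableC.
    by apply: etrans (probability_setC mu mF) _; rewrite muF subee.
  apply: negligibleS => -[w s] /= ns aw; apply: ns.
  (* A sum exceeding [D] at [s0] remains positive at every [s]. *)
  have [n nK] := aw (Num.truncn D).+1; exists n.
  have := osc n w s0 s; rewrite ler_distl => /andP[_].
  by have := truncnS_gt D; move: nK; rewrite /a; lra.
Qed.

(** * Iterated integration along a disintegration *)

Section disintegration.
Context d d' (Omega : measurableType d) (S : measurableType d') (R : realType).
Variables (P : probability Omega R) (mu : probability (Omega * S)%type R).
Variable nu : R.-pker Omega ~> S.
Hypothesis mu_nu : forall A, measurable A ->
  mu A = (\int[P]_w nu w (xsection A w))%E.

Import HBNNSimple.

Let disintegration_indic (A : set (Omega * S)) (r : R) :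
  measurable A -> (0 <= r)%R ->
  (\int[mu]_z (r * \1_A z)%:E = \int[P]_w \int[nu w]_s (r * \1_A (w, s))%:E)%E.
Proof.
move=> mA r0.
have mxA w : measurable (xsection A w) by exact: measurable_xsection.
have inner w : (\int[nu w]_s (\1_A (w, s))%:E = nu w (xsection A w))%E.
  transitivity (\int[nu w]_s (\1_(xsection A w) s)%:E)%E.
    by apply: eq_integral => s _; rewrite !indicE mem_xsection.
  by rewrite integral_indic// setIT.
have m1A : measurable_fun setT (fun z : Omega * S => (\1_A z)%:E : \bar R).
  exact/measurable_EFinP/measurable_indic.
under eq_integral do rewrite EFinM.
rewrite ge0_integralZl// integral_indic// setIT [X in (_ * X = _)%E](mu_nu mA).
under [RHS]eq_integral => w _.
  under eq_integral do rewrite EFinM.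
  rewrite ge0_integralZl//; last first.
    by apply: (measurable_fun_pair2 (f := fun z => (\1_A z)%:E)).
  rewrite inner; over.
rewrite ge0_integralZl//.
rewrite (_ : (fun w => _) = fun w => (\int[nu w]_s (\1_A (w, s))%:E)%E); last first.
  by apply/funext => w; rewrite inner.
by apply: (measurable_fun_integral_finite_kernel (fun z => (\1_A z)%:E) nu) => //.
Qed.

Let disintegration_nnsfun (h : {nnsfun (Omega * S) >-> R}) :
  (\int[mu]_z (h z)%:E = \int[P]_w \int[nu w]_s (h (w, s))%:E)%E.
Proof.
pose k r (z : Omega * S) : \bar R := (r * \1_(h @^-1` [set r]) z)%:E.
have mk r : measurable_fun setT (k r).
  by apply/measurable_EFinP; apply: measurable_funM => //; exact: measurable_indic.
have k0 r z : (0 <= k r z)%E by rewrite /k EFinM nnfun_muleindic_ge0.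
have hE z : (h z)%:E = (\sum_(r \in range h) k r z)%E.
  by rewrite fimfunE -fsumEFin.
under eq_integral do rewrite hE.
rewrite ge0_integral_fsum//.
under [RHS]eq_integral => w _.
  under eq_integral do rewrite hE.
  rewrite ge0_integral_fsum//; last by move=> r; exact: measurable_fun_pair2.
  over.
rewrite [RHS]ge0_integral_fsum//; last 2 first.
- by move=> r; exact: (measurable_fun_integral_finite_kernel (k r) nu).
- by move=> r w _; exact: integral_ge0.
(* The simple function [h] is nonnegative, so its negative levels are empty and contribute 0 to both
   sides. *)
apply: eq_fsbigr => r _; have [r0|r0] := leP 0 r.
  exact: disintegration_indic.
have k0' z : k r z = 0%E by rewrite /k preimage_nnfun0// indic0 mulr0.
rewrite integral0_eq// integral0_eq// => w _.
by rewrite integral0_eq.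
Qed.

(** Monotone convergence is used three times along simple approximations: for [mu], then for [P],
    then for each [nu w]. *)
Lemma ge0_integral_disintegration (h : Omega * S -> \bar R) :
  measurable_fun setT h -> (forall z, 0 <= h z)%E ->
  (\int[mu]_z h z = \int[P]_w \int[nu w]_s h (w, s))%E.
Proof.
move=> mh h0; pose h_ := nnsfun_approx measurableT mh.
have h_h z : lim ((h_ n z)%:E @[n --> \oo]) = h z.
  by apply/cvg_lim => //=; exact: cvg_nnsfun_approx.
have mh_ n : measurable_fun setT (fun z => (h_ n z)%:E) by exact/measurable_EFinP.
have mh2 n w : measurable_fun setT (fun s => (h_ n (w, s))%:E).
  exact: (measurable_fun_pair2 (f := fun z => (h_ n z)%:E)).
have nd z : {homo (fun n => (h_ n z)%:E) : m n / (m <= n)%N >-> (m <= n)%E}.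
  by move=> m n mn; rewrite lee_fin; exact/lefP/nd_nnsfun_approx.
under eq_integral do rewrite -h_h.
rewrite monotone_convergence//; last by move=> n z _; rewrite lee_fin.
under eq_fun do rewrite disintegration_nnsfun.
rewrite -monotone_convergence//; last 3 first.
- move=> n.
  apply: (measurable_fun_integral_finite_kernel (fun z => (h_ n z)%:E) nu) => //.
  by move=> z; rewrite lee_fin.
- by move=> n w _; apply: integral_ge0 => s _; rewrite lee_fin.
- move=> w _ m n mn; apply: ge0_le_integral => //.
  + by move=> s _; rewrite lee_fin.
  + by move=> s _; exact: nd.
apply: eq_integral => w _; rewrite -monotone_convergence//.
  by apply: eq_integral => s _; rewrite h_h.
by move=> n s _; rewrite lee_fin.
Qed.

(** Adding [C] makes [g] nonnegative. Since [mu], [P] and all [nu w] have mass one, the shift adds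
    exactly [C] to both sides and cancels. *)
Lemma Rintegral_disintegration (g : Omega * S -> R) (C : R) :
  measurable_fun setT g -> (forall z, `|g z| <= C) ->
  (\int[mu]_z g z)%:E = ('E_P[fun w => (\int[nu w]_s g (w, s))%R])%E.
Proof.
move=> mg gC; pose g' z := g z + C.
have g'0 z : 0 <= g' z by have := gC z; rewrite ler_norml /g'; lra.
have mg2 w : measurable_fun setT (fun s => g (w, s)) by exact: measurable_fun_pair2.
have intD d0 (X : measurableType d0) (m : {measure set X -> \bar R}) (u : X -> R) :
    m setT = 1%E -> measurable_fun setT u -> (forall x, `|u x| <= C) ->
    (\int[m]_x (u x + C)%:E = (\int[m]_x u x)%R%:E + C%:E)%E.
  move=> m1 mu_ uC; have moo : (m setT < +oo)%E by rewrite m1 ltry.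
  have iu := finite_measure_integrable moo mu_ uC.
  have iC : m.-integrable setT (EFin \o cst C).
    by apply: (@finite_measure_integrable _ _ _ _ _ `|C|).
  rewrite integralD_EFin// /Rintegral fineK; last exact: integrable_fin_num.
  by rewrite integral_cst//= m1 mule1.
pose phi w := \int[nu w]_s g (w, s).
have inner w : (\int[nu w]_s (g' (w, s))%:E)%E = (phi w + C)%:E.
  by rewrite /g' (intD _ _ (nu w) (fun s => g (w, s)))// prob_kernel.
(* Measurability of [phi] is read off from the integral of the nonnegative function [g'] against the
   kernel. *)
have mphi : measurable_fun setT phi.
  rewrite (_ : phi = fun w => fine (\int[nu w]_s (g' (w, s))%:E)%E - C); last first.
    by apply/funext => w; rewrite inner /= addrK.
  apply: measurable_funB => //; apply: measurableT_comp => //.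
  apply: (measurable_fun_integral_finite_kernel (fun z => (g' z)%:E) nu) => //.
  by apply/measurable_EFinP; exact: measurable_funD.
have phiC w : `|phi w| <= C.
  have noo : (nu w setT < +oo)%E by rewrite prob_kernel ltry.
  have ig := finite_measure_integrable noo (mg2 w) (fun s => gC (w, s)).
  apply: le_trans (le_normr_Rintegral _ ig) _ => //.
  apply: (@le_trans _ _ (\int[nu w]_s (cst C s))); last first.
    by rewrite Rintegral_cst// prob_kernel /= mulr1.
  apply: le_Rintegral => //.
    apply: (finite_measure_integrable (C := C) noo) => [|s].
      exact: measurableT_comp.
    by rewrite normr_id.
  by apply: (@finite_measure_integrable _ _ _ _ _ `|C|).
have mg' : measurable_fun setT (fun z => (g' z)%:E).
  by apply/measurable_EFinP; exact: measurable_funD.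
have g'0' z : (0 <= (g' z)%:E)%E by rewrite lee_fin.
have := ge0_integral_disintegration mg' g'0'.
under [X in _ = X -> _]eq_integral do rewrite inner.
rewrite (intD _ _ mu) //; last exact: probability_setT.
rewrite (intD _ _ P) //; last exact: probability_setT.
move=> /eqP.
rewrite -!EFinD eqe => /eqP /addIr ->.
rewrite unlock /Rintegral fineK//.
apply: integrable_fin_num => //.
exact: integrable_bounded mphi phiC.
Qed.

End disintegration.

(** * Convergence of averages and the random rotation number *)

(** After division by [n] the error is 1/(k + 1) + K/n, where [K] may depend on [k]. Indexing the
    slopes by integers leaves only countably many almost sure events to intersect later. *)
Lemma cvg_average_of_linear_bounds (R : realType) (u : nat -> R) (l : R) :
  (forall k : nat, exists K : R, forall n : nat,
    `|u n - n%:R * l| <= n%:R * k.+1%:R^-1 + K) ->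
  u n / n%:R @[n --> \oo] --> l.
Proof.
move=> ub; apply/cvgrPdist_le => /= e e0.
(* This [k] makes the slope at most e/2; the remaining e/2 absorbs K/n for large [n]. *)
have [K uK] := ub (Num.truncn (2 / e)).
have k_e : (Num.truncn (2 / e)).+1%:R^-1 <= e / 2.
  rewrite -[e / 2]invrK lef_pV2 ?posrE ?invr_gt0 ?divr_gt0// ?ltr0n//.
  by rewrite invf_div ltW// truncnS_gt.
exists (Num.truncn (`|K| * (2 / e))).+1 => // n /= Kn.
have n0 : 0 < n%:R :> R by rewrite ltr0n; apply: leq_trans Kn.
have nK : `|K| <= n%:R * (e / 2).
  rewrite -ler_pdivrMr ?divr_gt0// invf_div ltW//.
  by apply: lt_le_trans (truncnS_gt _) _; rewrite ler_nat.
have -> : l - u n / n%:R = - ((u n - n%:R * l) / n%:R).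
  by field; rewrite gt_eqF.
rewrite normrN normrM normfV [`|n%:R|]gtr0_norm// ler_pdivrMr//.
apply: le_trans (uK n) _; rewrite [leRHS]mulrC [in leRHS](splitr e) mulrDr.
apply: lerD; first by rewrite ler_pM2l.
exact: le_trans (ler_norm K) nK.
Qed.

Section random_homeomorphisms.
Context (R : realType) d (Omega : measurableType d) (P : probability Omega R).
Variables (theta : Omega -> Omega) (f : {RV P >-> Hplus R}) (q alpha : R).
Hypothesis theta_preserving : measure_preserving P theta.

Let F w := normalized_lift q alpha (f w).
Let g (z : Omega * S1 R) := on_circle (deviation (F z.1)) z.2.
Let Theta := skew_product theta f.

Let liftF w : is_lift (f w : Hplus R) (F w).
Proof. exact: (normalized_liftP q alpha (f w)).1. Qed.

Lemma deviation_covering w x : g (w, covering x) = F w x - x.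
Proof.
rewrite /g on_circle_covering// => z m.
by rewrite /deviation (liftDz (liftF w)); ring.
Qed.

(** Choose the preimage [x] of the circle point in [q, q + 1). Then [F w x] lies between [F w q] and
    [F w q + 1], with [F w q] in [alpha, alpha + 1), so the deviation lies between alpha - q - 1 and
    alpha - q + 2. *)
Lemma deviation_bounded z : `|g z| <= `|alpha - q| + 2.
Proof.
case: z => w s; have [/andP[qx xq] <-] := angleP q s.
rewrite deviation_covering; move: (angle q s) qx xq => x qx xq.
have /andP[Fq Fq'] := (normalized_liftP q alpha (f w)).2.
have F1 : F w q <= F w x by exact: (lift_le (liftF w)).
have F2 : F w x <= F w q + 1.
  by rewrite -(liftD1 (liftF w)); apply: (lift_le (liftF w)); exact: ltW.
have := ler_norm (alpha - q); have := ler_norm (- (alpha - q)); rewrite normrN.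
by move=> ? ?; rewrite ler_norml; apply/andP; split; rewrite -/(F w) in Fq Fq'; lra.
Qed.

Let measurable_F : measurable_fun setT (fun z : Omega * R => F z.1 z.2).
Proof.
apply: measurable_nondecreasing_continuous => [x|w|w].
- by apply: measurableT_comp (measurable_normalized_lift q alpha x) _.
- exact: (lift_le (liftF w)).
- by case: (liftF w).
Qed.

Let measurable_F_angle :
  measurable_fun setT (fun z : Omega * S1 R => F z.1 (angle q z.2)).
Proof.
have mp : measurable_fun setT (fun z : Omega * S1 R => (z.1, angle q z.2)).
  apply: measurable_fun_pair => //.
  exact: measurableT_comp (measurable_angle q) measurable_snd.
exact: (measurableT_comp measurable_F mp).
Qed.

(** The preimage chosen by [on_circle] carries no measurability; by periodicity it can be replaced
    by the measurable section [angle q]. *)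
Lemma measurable_deviation : measurable_fun setT g.
Proof.
rewrite (_ : g = fun z => F z.1 (angle q z.2) - angle q z.2); last first.
  apply/funext => -[w s]; have [_ es] := angleP q s.
  by rewrite -[in LHS]es deviation_covering.
apply: measurable_funB => //.
exact: measurableT_comp (measurable_angle q) measurable_snd.
Qed.

(** Joint measurability of the fibre map comes from factoring it through the line: [angle q], then
    the lift, then [covering]. *)
Lemma measurable_skew_product : measurable_fun setT Theta.
Proof.
apply: measurable_fun_pair.
  exact: measurableT_comp theta_preserving.1 measurable_fst.
rewrite (_ : (fun z => _) = fun z => covering (F z.1 (angle q z.2))).
  exact: measurableT_comp (@measurable_covering R) measurable_F_angle.
apply/funext => -[w s] /=; have [_ es] := angleP q s.
by rewrite -[in LHS]es; case: (liftF w) => _ _ ->.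
Qed.

Let iter_skew_product n w x :
  iter n Theta (w, covering x) = (iter n theta w, covering (cocycle theta F n w x)).
Proof.
elim: n => [//|n IH]; rewrite iterS IH /Theta /skew_product /=; congr pair.
by case: (liftF (iter n theta w)) => _ _ ->.
Qed.

(** The sum telescopes, because the iterates of [Theta] are covered by the cocycle of lifts. *)
Lemma birkhoff_sum_deviation n w x :
  birkhoff_sum Theta g n (w, covering x) = cocycle theta F n w x - x.
Proof.
rewrite /birkhoff_sum; elim: n => [|n IH]; first by rewrite big_ord0 subrr.
by rewrite big_ord_recr /= IH iter_skew_product deviation_covering /=; ring.
Qed.

Let cocycle_le n w : {homo cocycle theta F n w : x y / x <= y}.
Proof. by elim: n => [|n IH] x y xy //=; apply/(lift_le (liftF _))/IH. Qed.

Let cocycleDz n w x (m : int) :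
  cocycle theta F n w (x + m%:~R) = cocycle theta F n w x + m%:~R.
Proof. by elim: n => [//|n IH] /=; rewrite IH (liftDz (liftF _)). Qed.

(** The displacement is 1-periodic, so [y] may be replaced by some [z] in [x, x + 1). Both [z - x]
    and the difference of the two cocycle values then lie in [0, 1], whatever [n] is. *)
Lemma cocycle_displacement_osc n w x y :
  `|(cocycle theta F n w x - x) - (cocycle theta F n w y - y)| <= 1.
Proof.
have [z /andP[xz zx] /covering_eqP[m em]] := covering_surj x (covering y).
have -> : cocycle theta F n w y - y = cocycle theta F n w z - z.
  by rewrite em cocycleDz; ring.
have c1 : cocycle theta F n w x <= cocycle theta F n w z by exact: cocycle_le.
have c2 : cocycle theta F n w z <= cocycle theta F n w x + 1.
  by rewrite -(cocycleDz n w x 1); apply: cocycle_le; exact: ltW.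
by rewrite ler_norml; apply/andP; split; lra.
Qed.

Variable mu : probability (Omega * S1 R)%type R.
Hypothesis theta_ergodic : ergodic P theta.
Hypothesis mu_invariant : skew_invariant P theta f mu.

(** The factor [a] allows one statement to give both the upper bound ([a = 1]) and the lower bound
    ([a = -1]). It is applied to [h = a g - c], whose integral is negative and whose Birkhoff sums
    oscillate by at most [|a|] along a fibre. *)
Lemma cocycle_displacement_bounded_above (a c : R) :
  a * (\int[mu]_z g z) < c ->
  {ae P, forall w, exists K : nat, forall n,
    a * (cocycle theta F n w q - q) <= n%:R * c + K%:R}.
Proof.
move=> ac; pose h z := a * g z - c.
have sumh n z : birkhoff_sum Theta h n z = a * birkhoff_sum Theta g n z - n%:R * c.
  rewrite /birkhoff_sum /h sumrB -mulr_sumr; congr (_ - _).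
  by rewrite sumr_const card_ord mulr_natl.
have mh : measurable_fun setT h.
  apply: measurable_funB => //; apply: measurable_funM => //.
  exact: measurable_deviation.
have hC z : `|h z| <= `|a| * (`|alpha - q| + 2) + `|c|.
  apply: le_trans (ler_normB _ _) _; rewrite normrM lerD2r ler_wpM2l//.
  exact: deviation_bounded.
have muTheta : measure_preserving mu Theta.
  by split; [exact: measurable_skew_product|exact: mu_invariant.1].
have ig := integrable_bounded mu measurable_deviation deviation_bounded.
have int_h : \int[mu]_z h z < 0.
  rewrite RintegralB//; last 2 first.
  - apply: (@integrable_bounded _ _ _ _ _ (`|a| * (`|alpha - q| + 2))).
      by apply: measurable_funM => //; exact: measurable_deviation.
    by move=> z; rewrite normrM ler_wpM2l//; exact: deviation_bounded.
  - by apply: (@integrable_bounded _ _ _ _ _ `|c|).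
  rewrite RintegralZl// Rintegral_cst// [X in fine X]probability_setT mulr1.
  by rewrite subr_lt0.
have osc n w s s' :
    `|birkhoff_sum Theta h n (w, s) - birkhoff_sum Theta h n (w, s')| <= `|a|.
  have [_ <-] := angleP q s; have [_ <-] := angleP q s'.
  rewrite !sumh !birkhoff_sum_deviation.
  rewrite opprB addrA subrK -mulrBr normrM ler_piMr//.
  exact: cocycle_displacement_osc.
have := birkhoff_sum_bounded_above (covering q) theta_ergodic muTheta
  mu_invariant.2 (fun z => erefl) mh hC osc int_h.
apply: filterS => w [K wK]; exists K => n.
by have := wK n; rewrite sumh birkhoff_sum_deviation lerBlDl.
Qed.

Lemma rotation_number_ae :
  {ae P, forall w, is_rotation_number theta f q alpha w (\int[mu]_z g z)}.
Proof.
set I := \int[mu]_z g z.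
have up k : {ae P, forall w, exists K : nat, forall n,
    1 * (cocycle theta F n w q - q) <= n%:R * (I + k.+1%:R^-1) + K%:R}.
  by apply: cocycle_displacement_bounded_above; rewrite mul1r ltrDl invr_gt0.
have down k : {ae P, forall w, exists K : nat, forall n,
    (- 1) * (cocycle theta F n w q - q) <= n%:R * (- I + k.+1%:R^-1) + K%:R}.
  by apply: cocycle_displacement_bounded_above; rewrite mulN1r ltrDl invr_gt0.
(* One null set serves all slopes, since [k] ranges over a countable set. *)
move: (ae_foralln up) (ae_foralln down); apply: filterS2 => w wup wdown.
rewrite /is_rotation_number /= -/F => x.
apply: (@cvg_average_of_linear_bounds _ (fun n => cocycle theta F n w x - x)) => k.
have [K1 wK1] := wup k; have [K2 wK2] := wdown k.
(* [K1] and [K2] are nonnegative, so their sum dominates either of them; the 1 pays for passing from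
   the starting point [q] to [x]. *)
exists (K1%:R + K2%:R + 1) => n; rewrite ler_norml.
have := wK1 n; have := wK2 n; have := cocycle_displacement_osc n w x q.
rewrite ler_norml => /andP[]; rewrite -/F.
have : 0 <= K1%:R :> R by []. have : 0 <= K2%:R :> R by [].
rewrite mul1r mulN1r !mulrDr mulrN.
move: K1%:R K2%:R (n%:R * I) (n%:R / k.+1%:R) (cocycle _ _ _ _ x - x)
  (cocycle _ _ _ _ _ - q).
by move=> K1' K2' nI nk u v ? ? ? ? ? ?; apply/andP; split; lra.
Qed.

End random_homeomorphisms.

Theorem theorem2p3 (R : realType) (d : measure_display)
    (Omega : measurableType d) (P : probability Omega R)
    (theta : Omega -> Omega)
    (theta_preserving : measure_preserving P theta)
    (theta_ergodic : ergodic P theta)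
    (f : {RV P >-> Hplus R})
    (mu : probability (Omega * S1 R)%type R)
    (nu : R.-pker Omega ~> S1 R)
    (mu_invariant : skew_invariant P theta f mu)
    (mu_nu : disintegration P mu nu)
    (q alpha : R) :
  exists rho : R,
    {ae P, forall w, is_rotation_number theta f q alpha w rho} /\
    rho%:E = 'E_P[fun w => (\int[nu w]_s
      on_circle (deviation (normalized_lift q alpha (f w))) s)%R]%E.
Proof.
pose g (z : Omega * S1 R) :=
  on_circle (deviation (normalized_lift q alpha (f z.1))) z.2.
(* The integral over [mu] links the two claims: ergodicity identifies it with the limit, the
   disintegration with the expectation of fibre integrals. *)
exists (\int[mu]_z g z); split; first exact: rotation_number_ae.
exact: (Rintegral_disintegration mu_nu (measurable_deviation f q alpha)
  (deviation_bounded f q alpha)).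
Qed.
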